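(* If $G$ is a finite simple bipartite graph, then $b_2(G) = \frac{r_2(G)}{2}$. Furthermore, for a bipartition $V(G)=A\cup B$, there exists a minimum odd cover of $G$ that respects this bipartition, i.e., every biclique $(X,Y)$ in it has $X\subseteq A$ and $Y\subseteq B$ (or vice versa).
   Context: For a finite simple graph $G=(V,E)$, a biclique on a subset of $V$ is given by two disjoint sets $X,Y\subseteq V$ (written $(X,Y)$); its edges are all pairs $\{x,y\}$ with $x\in X$, $y\in Y$. An odd cover of $G$ is a collection of bicliques on subsets of $V$ such that every pair of vertices adjacent in $G$ is an edge of an odd number of the bicliques, and every pair of distinct non-adjacent vertices is an edge of an even number of the bicliques. $b_2(G)$ denotes the minimum cardinality of an odd cover of $G$. $r_2(G)$ denotes the rank over $\mathbb{F}_2$ of the adjacency matrix of $G$. *)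

(* Defs.v *)
From mathcomp Require Import all_boot all_order all_algebra.

Set Implicit Arguments.
Unset Strict Implicit.
Unset Printing Implicit Defensive.

Record sgraph (T : finType) := SGraph {
  adj : rel T;
  adj_sym : symmetric adj;
  adj_irrefl : irreflexive adj
}.

Section OddCovers.
Variable T : finType.

(* A biclique (X, Y); X or Y may be empty, in which case it has no edges. *)
Definition is_biclique (B : {set T} * {set T}) : bool := [disjoint B.1 & B.2].

Definition biclique_edge (B : {set T} * {set T}) (x y : T) : bool :=
  ((x \in B.1) && (y \in B.2)) || ((y \in B.1) && (x \in B.2)).

(* A collection of bicliques is a finite list, so repetitions are allowed and
   are counted with multiplicity. *)
Definition odd_cover (G : sgraph T) (C : seq ({set T} * {set T})) : bool :=
  all is_biclique C &&
  [forall x, forall y, (x != y) ==>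
     (odd (count (fun B => biclique_edge B x y) C) == adj G x y)].

Definition has_odd_cover_of_size (G : sgraph T) (n : nat) : bool :=
  [exists C : n.-tuple ({set T} * {set T}), odd_cover G C].

(* The single edges of G, each taken once, form an odd cover. *)
Lemma has_odd_cover (G : sgraph T) : exists n, has_odd_cover_of_size G n.
Proof.
pose lt (x y : T) := (enum_rank x < enum_rank y)%N.
pose s := [seq p <- enum {: T * T} | adj G p.1 p.2 && lt p.1 p.2].
pose C := [seq ([set p.1], [set p.2]) | p <- s].
exists (size C); apply/existsP; exists (in_tuple C); apply/andP; split.
  apply/allP=> B /mapP[p]; rewrite mem_filter => /andP[/andP[e _] _] ->.
  rewrite /is_biclique /= disjoints1 inE; apply: contraTneq e => ->.
  by rewrite adj_irrefl.
have lt_or x y : x != y -> lt x y = ~~ lt y x.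
  move=> nxy; rewrite /lt -leqNgt ltn_neqAle; case: eqP => // exy.
  by case/eqP: nxy; apply: enum_rank_inj; apply: val_inj.
have main x y : lt x y ->
    odd (count (fun B => biclique_edge B x y) C) = adj G x y.
  move=> lxy; rewrite count_map count_filter.
  rewrite (@eq_count _ _ (fun p => adj G x y && (p == (x, y)))); last first.
    case=> a b /=; rewrite /biclique_edge /= !inE xpair_eqE.
    rewrite [x == a]eq_sym [y == b]eq_sym [y == a]eq_sym [x == b]eq_sym.
    have [->|na] := eqVneq a x; have [->|nb] := eqVneq b y;
      rewrite ?andbF ?andbT ?orbF ?lxy ?andbT //=.
    - have [yx|] := eqVneq x y; last by [].
      by move: lxy; rewrite /lt yx ltnn.
    - have [yx|] := eqVneq a y; last by [].
      by have [yx'|//] := eqVneq y x; move: lxy; rewrite /lt yx' ltnn.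
    - have [-> |//] := eqVneq a y; have [-> |//] := eqVneq b x.
      by rewrite /= [lt y x]ltnNge (ltnW lxy) andbF.
  case: (adj G x y) => /=; last by rewrite count_pred0.
  by rewrite count_uniq_mem ?enum_uniq // mem_enum.
apply/forallP=> x; apply/forallP=> y; apply/implyP=> nxy.
have [lxy|] := boolP (lt x y); first by rewrite main.
rewrite -lt_or; last by rewrite eq_sym.
move=> lyx; rewrite adj_sym -main //; apply/eqP; congr (odd _).
by apply: eq_count => B; rewrite /biclique_edge orbC.
Qed.

Definition b2 (G : sgraph T) : nat := ex_minn (has_odd_cover G).

(* The vertices are ordered by their enumeration. *)
Definition adj_mx (G : sgraph T) : 'M['F_2]_#|T| :=
  (\matrix_(i, j) (adj G (enum_val i) (enum_val j))%:R)%R.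

Definition r2 (G : sgraph T) : nat := \rank (adj_mx G).

Definition bipartition (G : sgraph T) (A B : {set T}) : Prop :=
  [/\ [disjoint A & B], A :|: B = [set: T] &
      forall x y, adj G x y ->
        (x \in A /\ y \in B) \/ (x \in B /\ y \in A)].

Definition bipartite (G : sgraph T) : Prop := exists A B, bipartition G A B.

Definition respects (A B : {set T}) (C : seq ({set T} * {set T})) : Prop :=
  forall D, D \in C ->
    (D.1 \subset A /\ D.2 \subset B) \/ (D.1 \subset B /\ D.2 \subset A).

End OddCovers.

(* Main.v *)
Require Import Defs.
From mathcomp Require Import all_boot all_order all_algebra.

(** Over [F_2] an odd cover writes the adjacency matrix [M] as a sum of
    matrices [u v^T + v u^T], each of rank at most 2, so [r_2 <= 2 b_2]. For a
    bipartition [(A, B)], let [N] be the matrix [M] with the rows outside [A]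
    set to zero, so that [M = N + N^T]. The row spaces of [N] and [N^T] are
    supported on [B] and on [A] and both lie in that of [M], so
    [2 rank N <= r_2]. A rank factorization of [N] gives [rank N] bicliques
    from [A] to [B] that form an odd cover. *)

Set Implicit Arguments.
Unset Strict Implicit.
Unset Printing Implicit Defensive.

Import GRing.Theory.
Local Open Scope ring_scope.

Lemma natr_odd_F2 (n : nat) : (odd n)%:R = n%:R :> 'F_2.
Proof.
elim: n => // n IHn; rewrite oddS -natr1 -IHn.
by case: (odd n); apply: val_inj.
Qed.

Lemma natr_bool_inj (R : nzSemiRingType) :
  injective (fun b : bool => b%:R : R).
Proof.
by move=> [] [] //= /eqP; rewrite ?oner_eq0 // eq_sym oner_eq0.
Qed.

(** Vectors over ['F_2] are the indicators of their supports; this lets the factors of a matrix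
    factorization be read as vertex sets. *)
Lemma natr_neq0_F2 (a : 'F_2) : (a != 0)%:R = a.
Proof. by case: a => [[|[|n]] //= hn]; apply: val_inj. Qed.

Section Bicliques.
Variable T : finType.
Implicit Types (G : sgraph T) (B : {set T} * {set T}).
Implicit Types (C : seq ({set T} * {set T})) (X : {set T}).

Definition indicator_col X : 'cV['F_2]_#|T| :=
  \col_i (enum_val i \in X)%:R.

Definition biclique_mx B : 'M['F_2]_#|T| :=
  indicator_col B.1 *m (indicator_col B.2)^T
  + indicator_col B.2 *m (indicator_col B.1)^T.

Lemma biclique_mxE B i j : is_biclique B ->
  biclique_mx B i j = (biclique_edge B (enum_val i) (enum_val j))%:R.
Proof.
move=> dB; rewrite !mxE !big_ord1 !mxE /biclique_edge -!natrM !mulnb.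
rewrite [(_ \in B.2) && _]andbC -natrD.
(* If both products were 1 they would cancel in ['F_2]; disjointness of the two sides excludes
   this. *)
have [/= /andP[iX jY]|//] := boolP ((enum_val i \in B.1) && _).
by rewrite (disjointFl dB jY).
Qed.

Lemma mxrank_biclique B : (\rank (biclique_mx B) <= 2)%N.
Proof.
have rank1 X Y : (\rank (indicator_col X *m (indicator_col Y)^T) <= 1)%N.
  exact: leq_trans (mxrankM_maxl _ _) (rank_leq_col _).
exact: leq_trans (mxrank_add _ _) (leq_add (rank1 _ _) (rank1 _ _)).
Qed.

Lemma sum_biclique_mxE C i j : all (@is_biclique T) C ->
  (\sum_(B <- C) biclique_mx B) i j =
  (odd (count (fun B => biclique_edge B (enum_val i) (enum_val j)) C))%:R.
Proof.
move=> /allP allC; rewrite summxE natr_odd_F2 -sum1_count.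
rewrite [in RHS]big_mkcond natr_sum.
apply: eq_big_seq => B /allC /biclique_mxE ->.
by case: biclique_edge.
Qed.

Lemma odd_cover_mxP G C : all (@is_biclique T) C ->
  reflect (adj_mx G = \sum_(B <- C) biclique_mx B) (odd_cover G C).
Proof.
move=> allC; rewrite /odd_cover allC; apply: (iffP forallP) => [cov|eM x].
  apply/matrixP => i j; rewrite sum_biclique_mxE // mxE; congr _%:R.
  (* The cover condition is silent on the diagonal. There both sides vanish: [G] has no loops, and a
     biclique with disjoint sides has none either. *)
  have [<-|nij] := eqVneq i j.
    rewrite adj_irrefl (@eq_in_count _ _ pred0) ?count_pred0 // => B.
    move=> /(allP allC) dB; rewrite /biclique_edge orbb.
    by apply/andP=> -[/(disjointFr dB)->].
  have /forallP/(_ (enum_val j))/implyP := cov (enum_val i).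
  by rewrite (inj_eq enum_val_inj) => /(_ nij)/eqP->.
apply/forallP=> y; apply/implyP=> _; apply/eqP/(@natr_bool_inj 'F_2).
have := sum_biclique_mxE (enum_rank x) (enum_rank y) allC.
by rewrite -eM mxE !enum_rankK.
Qed.

Lemma r2_odd_cover G C : odd_cover G C -> (r2 G <= 2 * size C)%N.
Proof.
move=> cov; have /andP[allC _] := cov.
rewrite /r2 (odd_cover_mxP G allC cov) => {cov allC}.
elim: C => [|B C IH]; first by rewrite big_nil mxrank0.
rewrite big_cons mulnS (leq_trans (mxrank_add _ _)) //.
by rewrite leq_add // mxrank_biclique.
Qed.

Lemma b2_le G C : odd_cover G C -> (b2 G <= size C)%N.
Proof.
move=> cov; rewrite /b2; case: ex_minnP => n _; apply.
by apply/existsP; exists (in_tuple C).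
Qed.

Lemma b2_attained G : exists2 C, odd_cover G C & size C = b2 G.
Proof.
rewrite /b2; case: ex_minnP => n /existsP[C cov] _.
by exists C; rewrite ?size_tuple.
Qed.

Lemma r2_le_b2 G : (r2 G <= 2 * b2 G)%N.
Proof. by have [C cov <-] := b2_attained G; apply: r2_odd_cover. Qed.

End Bicliques.

Section Bipartite.
Variables (T : finType) (G : sgraph T) (A B : {set T}).
Hypothesis bipG : bipartition G A B.

Let M := adj_mx G.

(** The coordinate projection onto [X]: it kills the rows outside [X] from the left and the columns
    outside [X] from the right. *)
Definition part_mx (X : {set T}) : 'M['F_2]_#|T| :=
  diag_mx (indicator_col X)^T.

(** Kept at the full size of [M], not as a block indexed by [A] and [B], so that [N] and [N^T] can
    be added and their row spaces compared. *)
Definition biadj_mx : 'M['F_2]_#|T| :=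
  \matrix_(i, j) ((enum_val i \in A) && adj G (enum_val i) (enum_val j))%:R.

Let N := biadj_mx.

Lemma bipartition_inB x : (x \in B) = (x \notin A).
Proof.
have [dAB eAB _] := bipG; have := in_setT x; rewrite -eAB inE.
by have [/(disjointFr dAB)|] := boolP (x \in A).
Qed.

Lemma adj_bipartition x y : adj G x y -> (y \in A) = (x \notin A).
Proof.
have [_ _ h] := bipG; move=> /h; rewrite !bipartition_inB.
by case=> -[]; [move=> -> /negPf-> | move=> -> ->].
Qed.

Lemma biadj_mx_mul : N = part_mx A *m M.
Proof.
by apply/matrixP=> i j; rewrite mul_diag_mx !mxE -natrM mulnb.
Qed.

Lemma adj_mx_biadj : M = N + N^T.
Proof.
apply/matrixP=> i j; rewrite !mxE.
rewrite [adj G (enum_val j) _]adj_sym.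
have [/adj_bipartition->|_] := boolP (adj G _ _); last by rewrite !andbF addr0.
by case: (enum_val i \in A); rewrite /= ?addr0 ?add0r.
Qed.

Lemma trmx_biadj : N^T = part_mx B *m M.
Proof.
apply/matrixP=> i j; rewrite mul_diag_mx !mxE.
rewrite adj_sym bipartition_inB -natrM mulnb; congr _%:R.
have [/adj_bipartition->|_] := boolP (adj G _ _); last by rewrite !andbF.
by [].
Qed.

Lemma biadj_mx_part : N *m part_mx A = 0.
Proof.
apply/matrixP=> i j; rewrite mul_mx_diag !mxE -natrM mulnb.
have [/adj_bipartition->|_] := boolP (adj G _ _); last by rewrite andbF.
by case: (enum_val i \in A).
Qed.

Lemma trmx_biadj_part : N^T *m part_mx B = 0.
Proof.
apply/matrixP=> i j; rewrite mul_mx_diag !mxE -natrM mulnb.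
by rewrite bipartition_inB; case: (enum_val j \in A); rewrite ?andbF.
Qed.

Lemma part_mxD : part_mx A + part_mx B = 1%:M.
Proof.
apply/matrixP=> i j; rewrite !mxE bipartition_inB.
by case: eqP => // _; case: (enum_val i \in A); rewrite !(addr0, add0r).
Qed.

Lemma r2_ge_biadj : (2 * \rank N <= r2 G)%N.
Proof.
have cap0 : (N :&: N^T = 0)%MS.
  have /submxP[P eP] := capmxSl N N^T; have /submxP[Q eQ] := capmxSr N N^T.
  (* Split the intersection [W] as [W *m part_mx A + W *m part_mx B]. The first term vanishes
     because [W = P *m N], the second because [W = Q *m N^T]. *)
  rewrite -[LHS]mulmx1 -part_mxD mulmxDr {1}eP eQ -!mulmxA.
  by rewrite biadj_mx_part trmx_biadj_part !mulmx0 addr0.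
rewrite mul2n -addnn -{2}mxrank_tr -(mxrank_disjoint_sum cap0) mxrankS //.
by rewrite addsmx_sub trmx_biadj biadj_mx_mul !submxMl.
Qed.

(** Supports of the [k]-th column and the [k]-th row in the factorization
    [N = col_base N *m row_base N]. Cutting with [A] and [B] makes the sides respect the bipartition
    by construction. *)
Definition rank_biclique (k : 'I_(\rank N)) : {set T} * {set T} :=
  ([set x in A | col_base N (enum_rank x) k != 0],
   [set y in B | row_base N k (enum_rank y) != 0]).

Definition rank_cover : seq ({set T} * {set T}) :=
  [seq rank_biclique k | k <- enum 'I_(\rank N)].

Lemma size_rank_cover : size rank_cover = \rank N.
Proof. by rewrite size_map size_enum_ord. Qed.

Lemma rank_cover_respects : respects A B rank_cover.
Proof.
move=> _ /mapP[k _ ->]; left.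
by split; apply/subsetP=> x; rewrite inE => /andP[].
Qed.

Lemma biadj_mx_sum :
  N = \sum_k indicator_col (rank_biclique k).1
             *m (indicator_col (rank_biclique k).2)^T.
Proof.
apply/matrixP=> i j; rewrite summxE.
(* The cuts with [A] and [B] multiply each entry by two indicators; this is harmless, as [N]
   vanishes outside [A] times [B]. *)
transitivity ((enum_val i \in A)%:R * (enum_val j \in B)%:R * N i j).
  rewrite mxE -!natrM !mulnb bipartition_inB; congr _%:R.
  have [/adj_bipartition->|_] := boolP (adj G _ _); last by rewrite !andbF.
  by case: (enum_val i \in A).
rewrite -[in LHS](mulmx_base N) [X in _ * X]mxE mulr_sumr.
apply: eq_bigr => k _.
rewrite [RHS]mxE big_ord1 [_^T _ _]mxE ![indicator_col _ _ _]mxE.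
rewrite !inE !enum_valK.
by rewrite -!mulnb !natrM !natr_neq0_F2 mulrACA.
Qed.

Lemma rank_cover_odd : odd_cover G rank_cover.
Proof.
have dAB : [disjoint A & B] by case: bipG.
apply/odd_cover_mxP.
  apply/allP=> D /rank_cover_respects[] [sX sY]; apply: (disjointW sX sY).
    exact: dAB.
  by rewrite disjoint_sym.
(* The first summands of the biclique matrices add up to [N], the second ones, their transposes, to
   [N^T]. *)
rewrite big_map big_enum big_split /= -biadj_mx_sum -/M adj_mx_biadj.
congr (_ + _); rewrite [in LHS]biadj_mx_sum linear_sum.
by apply: eq_bigr => k _; rewrite /= trmx_mul trmxK.
Qed.

(** The cover above gives [b2 G <= \rank N], and the chain [2 * \rank N <= r2 G <= 2 * b2 G] gives
    the converse. *)
Lemma b2_rank_biadj : b2 G = \rank N.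
Proof.
apply/eqP; rewrite eqn_leq -{1}size_rank_cover b2_le ?rank_cover_odd //=.
by rewrite -(leq_pmul2l (isT : 0 < 2)%N) (leq_trans r2_ge_biadj) ?r2_le_b2.
Qed.

Lemma r2_bipartite : r2 G = (2 * b2 G)%N.
Proof.
by apply/eqP; rewrite eqn_leq r2_le_b2 b2_rank_biadj r2_ge_biadj.
Qed.

End Bipartite.

Theorem theorem4p4 (T : finType) (G : sgraph T) (hG : bipartite G) :
  ((b2 G)%:R = (r2 G)%:R / 2%:R :> rat)%R /\
  (forall A B : {set T}, bipartition G A B ->
     exists C : seq ({set T} * {set T}),
       [/\ odd_cover G C, size C = b2 G & respects A B C]).
Proof.
split=> [|A B bip].
  by case: hG => A [B /r2_bipartite->]; rewrite natrM mulrAC mulfV ?mul1r.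
exists (rank_cover G A B); split.
- exact: rank_cover_odd.
- by rewrite size_rank_cover (b2_rank_biadj bip).
- exact: rank_cover_respects.
Qed.
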